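(* Let $k\ge1$, let $Q\in\mathbb{R}^{d\times d}$ be skew-symmetric, $M\in\mathbb{R}^{d\times d}$ symmetric, $A=QM$, and let $U:\mathbb{R}^d\to\mathbb{R}$ be a polynomial of degree $k+2$. Then the $k$-step EKahan scheme $$x_{n+k}=e^{khA}x_n+kh\,\phi(khA)\,Q\,\nabla_{\mathrm K}U(x_n,x_{n+1},\ldots,x_{n+k})$$ for the system $\dot x=QMx+Q\nabla U(x)$ is symmetric; that is, $(x_n,x_{n+1},\ldots,x_{n+k})$ satisfies the scheme with step size $h$ if and only if the reversed sequence $(x_{n+k},x_{n+k-1},\ldots,x_n)$ satisfies the scheme with step size $-h$.
   Context: $\phi(z)=\frac{e^z-1}{z}$ (entire, $\phi(0)=1$), applied to matrices through its power series. Polarized gradient $\nabla_{\mathrm K}U$: if $U$ is homogeneous of degree $k+2$, $$\nabla_{\mathrm K}U(x_n,\ldots,x_{n+k})=\sum_{\substack{1\le m\le k+1\\ n\le i_1<\cdots<i_m\le n+k}}\frac{(-1)^{k+1-m}}{(k+1)!}\,\nabla U(x_{i_1}+\cdots+x_{i_m}),$$ the symmetric $(k+1)$-linear polarization of $\nabla U$. If $U$ is a nonhomogeneous polynomial of degree $k+2$, let $\bar U(s,x)$ be the homogeneous polynomial of degree $k+2$ in $(s,x)\in\mathbb{R}\times\mathbb{R}^d$ with $\bar U(1,x)=U(x)$; then $\nabla_{\mathrm K}U(x_n,\ldots,x_{n+k})$ is the $x$-component of the polarization of $\nabla\bar U$ at $(1,x_n),\ldots,(1,x_{n+k})$, i.e.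 the same sum with $\nabla U(x_{i_1}+\cdots+x_{i_m})$ replaced by $\nabla_x\bar U(m,x_{i_1}+\cdots+x_{i_m})$. *)

(* Defs.v *)
From mathcomp Require Import all_boot all_order all_algebra.
(* The notations of mpoly clash with those of MathComp-Analysis. *)
From mathcomp Require Import -(notations) mpoly.
From mathcomp Require Import all_classical all_reals all_analysis.
Import numFieldNormedType.Exports.
Import Order.TTheory GRing.Theory Num.Theory.

Set Implicit Arguments.
Unset Strict Implicit.
Unset Printing Implicit Defensive.

Local Open Scope ring_scope.

Notation "{ 'mpoly' T [ n ] }" := (mpoly n T)
  (at level 0, T, n at level 2, format "{ 'mpoly'  T [ n ] }").

Definition mx_pseries (R : realType) (d : nat) (c : nat -> R) (A : 'M[R]_d) :
    'M[R]_d :=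
  limn (series (fun j => c j *: A ^+ j)).

Definition mx_exp (R : realType) (d : nat) (A : 'M[R]_d) : 'M[R]_d :=
  mx_pseries (fun j => j`!%:R^-1) A.

(* Taylor coefficients of (e^z - 1) / z at 0; see phi_coeff_cvg. *)
Definition phi_coeff (R : realType) (j : nat) : R := j.+1`!%:R^-1.

Definition mx_phi (R : realType) (d : nat) (A : 'M[R]_d) : 'M[R]_d :=
  mx_pseries (@phi_coeff R) A.

Definition mgrad (R : comNzRingType) (n : nat) (p : {mpoly R[n]})
    (v : 'cV[R]_n) : 'cV[R]_n :=
  \col_i meval (fun j => v j 0) (mderiv i p).

(* The variable of index lshift n 0 is the homogenizing variable s, and those
   of index rshift 1 i are the original ones.  The truncated subtraction is
   harmless as soon as e is at least the degree of p. *)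
Definition mhomogenize (R : comNzRingType) (n e : nat) (p : {mpoly R[n]}) :
    {mpoly R[1 + n]} :=
  \sum_(m <- msupp p)
    mcoeff m p *:
      (mpolyX R (mnm1 (@lshift 1 n 0)) ^+ (e - mdeg m) *
       \prod_(i < n) mpolyX R (mnm1 (rshift 1 i)) ^+ m i).

(* Sum over the nonempty sets I = {i_1 < ... < i_m} of positions in the
   (k+1)-tuple v.  For p homogeneous of degree k + 2 this is the symmetric
   (k+1)-linear polarization of the gradient of p. *)
Definition polar_grad (R : comUnitRingType) (n k : nat) (p : {mpoly R[n]})
    (v : 'I_k.+1 -> 'cV[R]_n) : 'cV[R]_n :=
  \sum_(I : {set 'I_k.+1} | (0 < #|I|)%N)
    ((-1) ^+ (k.+1 - #|I|) / k.+1`!%:R) *: mgrad p (\sum_(i in I) v i).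

(* The x-component of the polarized gradient of the homogenization of U at the
   points (1, x i).  When U is itself homogeneous of degree k + 2 this is
   polar_grad U x; see gradK_homog. *)
Definition gradK (R : comUnitRingType) (d k : nat) (U : {mpoly R[d]})
    (x : 'I_k.+1 -> 'cV[R]_d) : 'cV[R]_d :=
  dsubmx (polar_grad (mhomogenize k.+2 U) (fun i => col_mx 1%:M (x i))).

(* x = (x_n, ..., x_(n+k)), indexed by 'I_k.+1 *)
Definition ekahan (R : realType) (d k : nat) (Q M : 'M[R]_d)
    (U : {mpoly R[d]}) (h : R) (x : 'I_k.+1 -> 'cV[R]_d) : Prop :=
  let A := Q *m M in
  x ord_max = mx_exp ((k%:R * h) *: A) *m x ord0 +
    (k%:R * h) *: (mx_phi ((k%:R * h) *: A) *m Q *m gradK U x).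

Definition symmetric_scheme (R : realType) (d k : nat)
    (S : R -> ('I_k.+1 -> 'cV[R]_d) -> Prop) : Prop :=
  forall (h : R) (x : 'I_k.+1 -> 'cV[R]_d),
    S h x <-> S (- h) (fun i => x (rev_ord i)).

Lemma phi_coeff_cvg (R : realType) (z : R) : z != 0 ->
  (series (fun j => phi_coeff R j * z ^+ j) @ \oo --> (expR z - 1) / z)%classic.
Proof.
move=> z0.
have h : (series (exp_coeff z) @ \oo --> expR z)%classic.
  exact: is_cvg_series_exp_coeff.
rewrite -cvg_shiftS in h.
suff -> : series (fun j => phi_coeff R j * z ^+ j) =
    (fun n => (series (exp_coeff z) n.+1 - 1) / z).
  by apply: cvgMr_tmp; apply: cvgB => //; exact: cvg_cst.
apply/funext => n; rewrite /series /= big_nat_recl // /exp_coeff /=.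
rewrite expr0 fact0 divr1 addrAC subrr add0r mulr_suml.
apply: eq_bigr => i _; rewrite /phi_coeff exprSr.
by rewrite [RHS]mulrAC mulfK // mulrC.
Qed.

Section Homogenization.
Context (R : comNzRingType) (n : nat).
Implicit Types (p : {mpoly R[n]}) (x : 'cV[R]_n).

Lemma meval_mhomogenize e p (s : R) x :
  meval (fun j => (col_mx s%:M x) j 0) (mhomogenize e p) =
  \sum_(m <- msupp p)
    mcoeff m p * (s ^+ (e - mdeg m) * \prod_(i < n) x i 0 ^+ m i).
Proof.
rewrite /mhomogenize raddf_sum /=; apply: eq_bigr => m _.
rewrite mevalZ mevalM rmorphXn /= mevalXU col_mxEu mxE eqxx mulr1n.
rewrite rmorph_prod; do 2!congr (_ * _); apply: eq_bigr => i _.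
by rewrite rmorphXn /= mevalXU col_mxEd.
Qed.

Lemma mhomogenize_at1 e p x :
  meval (fun j => (col_mx 1%:M x) j 0) (mhomogenize e p) =
  meval (fun i => x i 0) p.
Proof.
rewrite meval_mhomogenize mevalE; apply: eq_bigr => m _.
by rewrite expr1n mul1r.
Qed.

Lemma mhomogenize_homog e p : (msize p <= e.+1)%N ->
  mhomogenize e p \is ishomog1 e mdeg.
Proof.
move=> pe; rewrite /mhomogenize big_seq; apply: rpred_sum => m mp.
apply: dhomogZ.
have me : (mdeg m <= e)%N by rewrite -ltnS (leq_trans (msize_mdeg_lt mp)).
rewrite -[X in ishomog1 X](subnK me); apply: dhomogM.
  rewrite -[X in ishomog1 X]mul1n; apply: dhomogMn.
  by rewrite dhomogX /= mdeg1.
rewrite mdegE; elim/big_rec2 : _ => [|i q c _ ih]; first exact: dhomog1.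
apply: dhomogM => //; rewrite -[X in ishomog1 X]mul1n; apply: dhomogMn.
by rewrite dhomogX /= mdeg1.
Qed.

Lemma mgrad_mhomogenize_homog e p (v : 'cV[R]_(1 + n)) :
  p \is ishomog1 e mdeg ->
  dsubmx (mgrad (mhomogenize e p) v) = mgrad p (dsubmx v).
Proof.
move=> /dhomogP hp; apply/colP => i; rewrite !mxE.
pose M (m : multinom n) : multinom (1 + n) :=
  Multinom [tuple (if fintype.split j is inr l then m l else 0%N) | j < 1 + n].
have MrE m l : M m (rshift 1 l) = m l.
  by rewrite /M multinomE tnth_mktuple; case: split_ordP => j /eqP;
    rewrite eq_shift // => /eqP <-.
have MlE m l : M m (lshift n l) = 0%N.
  by rewrite /M multinomE tnth_mktuple; case: split_ordP => j /eqP;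
    rewrite eq_shift.
have -> : mhomogenize e p = \sum_(m <- msupp p) mcoeff m p *: mpolyX R (M m).
  rewrite /mhomogenize big_seq [RHS]big_seq; apply: eq_bigr => m mp.
  rewrite hp // subnn expr0 mul1r [in RHS]mpolyXE_id big_split_ord /=.
  rewrite big_ord1 MlE expr0 mul1r; congr (_ *: _).
  by apply: eq_bigr => l _; rewrite MrE.
rewrite [in RHS](mpolyE p) !(raddf_sum (mderiv _)) !(raddf_sum (meval _)) /=.
apply: eq_bigr => m _ /=.
rewrite !mderivZ !mevalZ !mderivX !mevalZ !mevalX MrE; congr (_ * (_ * _)).
rewrite big_split_ord /= big_ord1 mnmBE MlE sub0n expr0 mul1r.
apply: eq_bigr => l _; rewrite !mnmBE MrE !mnmE !mxE.
by rewrite eq_shift.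
Qed.

End Homogenization.

Lemma gradK_homog (R : comUnitRingType) (d k : nat) (U : {mpoly R[d]})
    (x : 'I_k.+1 -> 'cV[R]_d) :
  U \is ishomog1 k.+2 mdeg -> gradK U x = polar_grad U x.
Proof.
move=> hU; rewrite /gradK /polar_grad linear_sum /=; apply: eq_bigr => I _.
rewrite linearZ /= mgrad_mhomogenize_homog // linear_sum /=.
by congr (_ *: mgrad U _); apply: eq_bigr => i _; rewrite col_mxKd.
Qed.

(* Main.v *)
Require Import Defs.
From HB Require Import structures.
From mathcomp Require Import all_boot all_order all_algebra.
From mathcomp Require Import -(notations) mpoly.
From mathcomp Require Import all_classical all_reals all_analysis.
From mathcomp Require Import ring.
Import numFieldNormedType.Exports.
Import Order.TTheory GRing.Theory Num.Theory.

(** Two facts make the scheme symmetric.  The polarized gradient is a sum over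
    all nonempty sets of points, weighted by a function of the cardinality
    alone, so it takes the same value [g] on the reversed sequence
    ([gradK_rev]).  And, with [B = khA], the entire functions of the scheme
    satisfy [exp(-B) exp(B) = 1] ([mx_expN_mul]) and [exp(-B) phi(B) = phi(-B)]
    ([mx_expN_phi]).  Multiplying
    [x_(n+k) = exp(B) x_n + kh phi(B) Q g] by [exp(-B)] therefore gives
    [x_n = exp(-B) x_(n+k) - kh phi(-B) Q g], which is the scheme with step
    [-h] for the reversed sequence ([ekahan_rev]).  Reversal is an involution,
    so this implication is also its own converse.

    The two identities are instances of one product formula for matrix power
    series whose coefficients are bounded by those of [exp] ([mx_pseriesM]):
    the product is the series of the Cauchy product of the coefficients.  The
    product of two partial sums of length [N] exceeds the partial sum of the
    Cauchy product by the terms with [i, j < N <= i + j] ([partial_sumsM]).  In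
    norm these terms are at most the corresponding ones for the scalar series
    of [exp r] with [r = d * `|B|], and their sum tends to
    [exp r * exp r - exp (r + r) = 0] ([exp_coeff_cauchy_tail]). *)

Local Open Scope classical_set_scope.
Local Open Scope ring_scope.

(** * Invariance of the polarized gradient under permutations *)

(** A bijection of the positions permutes the index sets of the sum and
    preserves their cardinalities, hence their weights. *)
Lemma polar_grad_reindex {R : comUnitRingType} {n k : nat} (p : {mpoly R[n]})
    (v : 'I_k.+1 -> 'cV[R]_n) (s : 'I_k.+1 -> 'I_k.+1) : injective s ->
  polar_grad p (v \o s) = polar_grad p v.
Proof.
move=> s_inj; rewrite /polar_grad [RHS](reindex_inj (imset_inj s_inj)) /=.
apply: eq_big => [I|I _]; first by rewrite card_imset.
rewrite card_imset // big_imset //=; exact: in2W s_inj.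
Qed.

Lemma gradK_rev {R : comUnitRingType} {d k : nat} (U : {mpoly R[d]})
    (x : 'I_k.+1 -> 'cV[R]_d) :
  gradK U (fun i => x (rev_ord i)) = gradK U x.
Proof.
by rewrite /gradK -[in RHS](polar_grad_reindex _ _ _ rev_ord_inj).
Qed.

(** * Cauchy products *)

(** The square [i, j < N] is cut along the antidiagonal [i + j = N]; the lower
    triangle is summed by antidiagonals [i + j = n]. *)
Lemma partial_sumsM {V : pzRingType} (u v : nat -> V) (N : nat) :
  (\sum_(0 <= i < N) u i) * (\sum_(0 <= j < N) v j) =
  \sum_(0 <= n < N) \sum_(0 <= i < n.+1) u i * v (n - i)%N +
  \sum_(0 <= i < N) \sum_(0 <= j < N | (N <= i + j)%N) u i * v j.
Proof.
have -> : \sum_(0 <= n < N) \sum_(0 <= i < n.+1) u i * v (n - i)%N =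
    \sum_(0 <= i < N) \sum_(0 <= j < N | (i + j < N)%N) u i * v j.
  transitivity (\sum_(0 <= n < N) \sum_(0 <= i < N | (i <= n)%N)
      u i * v (n - i)%N).
    apply: eq_big_nat => n /andP[_ nN].
    by rewrite (big_nat_widen _ _ N).
  rewrite (exchange_big_dep_nat xpredT) //=; apply: eq_big_nat => i /andP[_ iN].
  transitivity (\sum_(i <= n < N) u i * v (n - i)%N).
    by rewrite [RHS](big_nat_widenl _ 0).
  rewrite -[X in \sum_(X <= _ < _) _]add0n big_addn.
  rewrite (big_nat_widen _ _ N) ?leq_subr //.
  apply: eq_big => [j|j _]; first by rewrite /= ltn_subRL.
  by rewrite addnK.
rewrite mulr_suml -big_split /=; apply: eq_bigr => i _.
rewrite mulr_sumr (bigID (fun j => (i + j < N)%N)) /=; congr (_ + _).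
by apply: eq_bigl => j; rewrite -leqNgt.
Qed.

(** The binomial formula divided by [n!]. *)
Lemma exp_coeff_cauchy {R : realType} (x y : R) (n : nat) :
  \sum_(0 <= i < n.+1) exp_coeff x i * exp_coeff y (n - i)%N =
  exp_coeff (x + y) n.
Proof.
rewrite /exp_coeff /= addrC exprDn mulr_suml big_mkord.
apply: eq_bigr => i _.
have in_ : (i <= n)%N by rewrite -ltnS.
have bne (m : nat) : m`!%:R != 0 :> R by rewrite pnatr_eq0 -lt0n fact_gt0.
have binne : 'C(n, i)%:R != 0 :> R by rewrite pnatr_eq0 -lt0n bin_gt0.
rewrite -(bin_fact in_) !natrM -mulr_natr; field.
by rewrite !bne.
Qed.

(** By the two preceding lemmas the sum is the difference between the square of
    a partial sum of [exp r] and a partial sum of [exp (r + r)], so the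
    functional equation of the scalar exponential gives the limit. *)
Lemma exp_coeff_cauchy_tail {R : realType} (r : R) :
  (fun N => \sum_(0 <= i < N) \sum_(0 <= j < N | (N <= i + j)%N)
     exp_coeff r i * exp_coeff r j) @ \oo --> (0 : R)%R.
Proof.
have cvg_exp (z : R) : series (exp_coeff z) @ \oo --> expR z.
  exact: is_cvg_series_exp_coeff.
rewrite [X in _ --> X](_ : 0 = expR r * expR r - expR (r + r)); last first.
  by rewrite expRD subrr.
apply: cvg_trans; last first.
  exact: (cvgB (cvgM (cvg_exp r) (cvg_exp r)) (cvg_exp (r + r))).
apply: near_eq_cvg; apply: nearW => N.
rewrite !fctE /series /= partial_sumsM addrAC.
under [X in X - _]eq_bigr do rewrite exp_coeff_cauchy.
by rewrite subrr add0r.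
Qed.

(** * Matrix norms *)

(** Joins completeness with the norm, so that absolutely convergent series of
    matrices converge. *)
HB.instance Definition _ (R : realType) (m n : nat) :=
  Complete.on 'M[R]_(m, n).

Lemma ler_norm_entry {R : realType} {m n : nat} (X : 'M[R]_(m, n)) i j :
  `|X i j| <= `|X|.
Proof.
rewrite [leRHS]/Num.Def.normr /= mx_normrE.
by apply/bigmax_geP; right; exists (i, j).
Qed.

Lemma mx_norm_le {R : realType} {m n : nat} (X : 'M[R]_(m, n)) (b : R) :
  0 <= b -> (forall i j, `|X i j| <= b) -> `|X| <= b.
Proof.
move=> b0 Xb; rewrite /Num.Def.normr /= mx_normrE.
by apply/bigmax_leP; split=> //= ij _.
Qed.

(** The norm is the maximum of the entries, for which the product is
    submultiplicative only up to the inner dimension. *)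
Lemma ler_norm_mulmx {R : realType} {m n p : nat} (X : 'M[R]_(m, n))
    (Y : 'M[R]_(n, p)) :
  `|X *m Y| <= n%:R * (`|X| * `|Y|).
Proof.
apply: mx_norm_le => [|i j]; first by rewrite !mulr_ge0.
rewrite mxE (le_trans (ler_norm_sum _ _ _)) //.
rewrite mulr_natl -[leRHS](_ : \sum_(l < n) `|X| * `|Y| = _); last first.
  by rewrite sumr_const card_ord.
by apply: ler_sum => l _; rewrite normrM ler_pM // ler_norm_entry.
Qed.

Lemma ler_norm_expmx {R : realType} {d : nat} (B : 'M[R]_d) (n : nat) :
  `|B ^+ n| <= (d%:R * `|B|) ^+ n.
Proof.
elim: n => [|n IHn].
  rewrite !expr0; apply: mx_norm_le => // i j.
  by rewrite mxE; case: eqP; rewrite ?normr1 ?normr0.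
rewrite !exprS -mulrA (le_trans (ler_norm_mulmx _ _)) //.
by rewrite ler_wpM2l // ler_wpM2l.
Qed.

Lemma cvg_mulmx {R : realType} {m n p : nat} (u : nat -> 'M[R]_(m, n))
    (v : nat -> 'M[R]_(n, p)) (X : 'M[R]_(m, n)) (Y : 'M[R]_(n, p)) :
  u @ \oo --> X -> v @ \oo --> Y -> (fun N => u N *m v N) @ \oo --> X *m Y.
Proof.
move=> uX vY; apply/subr_cvg0; apply: norm_cvg0.
have u0 : (fun N => `|u N - X|) @ \oo --> (0 : R).
  by move/subr_cvg0: uX => /cvg_norm; rewrite normr0; apply.
have v0 : (fun N => `|v N - Y|) @ \oo --> (0 : R).
  by move/subr_cvg0: vY => /cvg_norm; rewrite normr0; apply.
apply: (@squeeze_cvgr _ _ _ _ (fun=> 0)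
  (fun N => n%:R * (`|u N - X| * `|v N|) + n%:R * (`|X| * `|v N - Y|))).
- apply: nearW => N; rewrite normr_ge0 /=.
  have -> : u N *m v N - X *m Y = (u N - X) *m v N + X *m (v N - Y).
    by rewrite mulmxBl mulmxBr addrA subrK.
  by rewrite (le_trans (ler_normD _ _)) // lerD // ler_norm_mulmx.
- exact: cvg_cst.
- rewrite [X in _ --> X](_ : 0 = n%:R * (0 * `|Y|) + n%:R * (`|X| * 0)).
    apply: cvgD; apply: cvgMr; apply: cvgM => //; first exact: cvg_norm.
    exact: cvg_cst.
  by rewrite mul0r !mulr0 addr0.
Qed.

(** * Power series of matrices *)

Section MatrixPowerSeries.
Context {R : realType} {d : nat}.
Implicit Types (B : 'M[R]_d) (c : nat -> R).

Definition exp_dominated c := forall j, `|c j| <= j`!%:R^-1.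

Lemma norm_term_le B c j : exp_dominated c ->
  `|c j *: B ^+ j| <= exp_coeff (d%:R * `|B|) j.
Proof.
move=> cd; rewrite normrZ /exp_coeff /= mulrC.
by rewrite ler_pM // ler_norm_expmx.
Qed.

Lemma mx_pseries_cvg B c : exp_dominated c ->
  series (fun j => c j *: B ^+ j) @ \oo --> mx_pseries c B.
Proof.
move=> cd; apply: normed_cvg.
apply: (series_le_cvg _ _ _ (is_cvg_series_exp_coeff (d%:R * `|B|))) => j.
- exact: normr_ge0.
- by rewrite exp_coeff_ge0 // mulr_ge0.
- exact: norm_term_le.
Qed.

(** Mertens' theorem for matrix series that the exponential series dominates. *)
Lemma mx_pseriesM B c c' : exp_dominated c -> exp_dominated c' ->
  mx_pseries c B *m mx_pseries c' B =
  mx_pseries (fun n => \sum_(0 <= i < n.+1) c i * c' (n - i)%N) B.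
Proof.
move=> cd c'd; apply/esym/cvg_lim => //.
pose u j := c j *: B ^+ j; pose v j := c' j *: B ^+ j.
pose tail N := \sum_(0 <= i < N) \sum_(0 <= j < N | (N <= i + j)%N) u i *m v j.
pose r := d%:R * `|B|.
have r0 : 0 <= r by rewrite mulr_ge0.
have tail0 : tail @ \oo --> (0 : 'M[R]_d).
  apply: norm_cvg0.
  apply: (squeeze_cvgr _ (cvg_cst 0) (exp_coeff_cauchy_tail r)).
  apply: nearW => N; rewrite normr_ge0 /= (le_trans (ler_norm_sum _ _ _)) //.
  apply: ler_sum => i _; rewrite (le_trans (ler_norm_sum _ _ _)) //.
  apply: ler_sum => j _.
  rewrite -scalemxAl -scalemxAr -[B ^+ i *m _]exprD scalerA normrZ normrM.
  rewrite /exp_coeff /= mulrACA -exprD mulrC.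
  by rewrite ler_pM ?mulr_ge0 ?ler_norm_expmx ?ler_pM ?cd ?c'd.
rewrite -[_ *m _]subr0.
apply: cvg_trans; last first.
  exact: (cvgB (cvg_mulmx _ _ _ _ (mx_pseries_cvg B c cd)
    (mx_pseries_cvg B c' c'd)) tail0).
apply: near_eq_cvg; apply: nearW => N; rewrite !fctE /series /=.
rewrite [X in X - _](partial_sumsM u v) addrK; apply: eq_bigr => n _.
rewrite scaler_suml; apply: eq_big_nat => i /andP[_ in_].
rewrite -[u i * _]/(u i *m _) -scalemxAl -scalemxAr -[B ^+ i *m _]exprD scalerA.
by rewrite subnKC.
Qed.

Lemma mx_pseriesN B c :
  mx_pseries c (- B) = mx_pseries (fun j => (-1) ^+ j * c j) B.
Proof.
rewrite /mx_pseries; congr (limn (series _)); apply/funext => j.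
suff -> : (- B) ^+ j = (-1) ^+ j *: B ^+ j by rewrite scalerA mulrC.
elim: j => [|j IHj]; first by rewrite !expr0 scale1r.
rewrite !exprS IHj -[- B * _]/(- B *m _) -scalemxAr mulNmx.
rewrite -[- (B *m _)]scaleN1r.
by rewrite scalerA mulrC.
Qed.


Lemma exp_dominatedN c : exp_dominated c ->
  exp_dominated (fun j => (-1) ^+ j * c j).
Proof. by move=> cd j; rewrite normrM normrX normrN1 expr1n mul1r. Qed.

Lemma mx_pseries_const B c : (forall j, c j.+1 = 0) ->
  mx_pseries c B = (c 0%N)%:M.
Proof.
move=> c0; apply/cvg_lim => //; rewrite -cvg_shiftS /series /=.
apply: (@cvg_trans _ ((fun=> (c 0%N)%:M : 'M[R]_d) @ \oo)).
  2: exact: cvg_cst.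
apply: near_eq_cvg; apply: nearW => N.
rewrite big_nat_recl // big1 => [|j _]; last by rewrite c0 scale0r.
by rewrite addr0 expr0 -scalemx1.
Qed.

Lemma exp_dominated_exp : exp_dominated (fun j => j`!%:R^-1).
Proof. by move=> j; rewrite ger0_norm. Qed.

Lemma exp_dominated_phi : exp_dominated (phi_coeff R).
Proof.
move=> j; rewrite /phi_coeff ger0_norm // lef_pV2 ?posrE ?ltr0n ?fact_gt0 //.
by rewrite ler_nat factS leq_pmull.
Qed.

(** The Cauchy product of [exp (- z)] and [exp z] is the constant series 1. *)
Lemma exp_cauchyN1 (n : nat) :
  \sum_(0 <= i < n.+1) (-1) ^+ i * i`!%:R^-1 * (n - i)`!%:R^-1 =
  (n == 0%N)%:R :> R.
Proof.
transitivity (exp_coeff (-1 + 1 : R) n).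
  rewrite -exp_coeff_cauchy; apply: eq_bigr => i _.
  by rewrite /exp_coeff /= expr1n mul1r.
rewrite /exp_coeff /= addNr expr0n; case: n => [|n]; last by rewrite mul0r.
by rewrite fact0 divr1.
Qed.

Lemma mx_expN_mul B : mx_exp (- B) *m mx_exp B = 1%:M.
Proof.
have ed := exp_dominated_exp.
rewrite /mx_exp mx_pseriesN mx_pseriesM //; last exact: exp_dominatedN.
rewrite mx_pseries_const => [|j]; last by rewrite exp_cauchyN1.
by rewrite exp_cauchyN1.
Qed.

Lemma mx_expN_phi B : mx_exp (- B) *m mx_phi B = mx_phi (- B).
Proof.
have ed := exp_dominatedN _ exp_dominated_exp.
rewrite /mx_exp /mx_phi !mx_pseriesN mx_pseriesM //.
  2: exact: exp_dominated_phi.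
congr mx_pseries; apply/funext => n; rewrite /phi_coeff.
(* This convolution is the one of exp (- z) and exp z in degree n.+1, which
   vanishes, without its last term, that of i = n.+1. *)
have /esym := exp_cauchyN1 n.+1.
rewrite big_nat_recr //= subnn fact0 invr1 mulr1.
rewrite exprS mulN1r mulNr => /eqP; rewrite eq_sym subr_eq0 => /eqP <-.
by apply: eq_big_nat => i /andP[_ in_]; rewrite subSn.
Qed.

End MatrixPowerSeries.

(** * Reversal of the scheme *)

Lemma ekahan_rev {R : realType} {d k : nat} (Q M : 'M[R]_d) (U : {mpoly R[d]})
    (h : R) (x : 'I_k.+1 -> 'cV[R]_d) :
  ekahan Q M U h x -> ekahan Q M U (- h) (fun i => x (rev_ord i)).
Proof.
rewrite /ekahan /= gradK_rev => x_step.
have -> : rev_ord (ord_max : 'I_k.+1) = ord0 by apply/val_inj; rewrite /= subnn.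
have -> : rev_ord (ord0 : 'I_k.+1) = ord_max by apply/val_inj; rewrite /= subn1.
rewrite mulrN !scaleNr x_step mulmxDr -scalemxAr !mulmxA.
by rewrite mx_expN_mul mul1mx mx_expN_phi addrK.
Qed.

Theorem theorem4 (R : realType) (d k : nat) (hk : (1 <= k)%N)
    (Q M : 'M[R]_d) (hQ : Q^T = - Q) (hM : M^T = M)
    (U : {mpoly R[d]}) (hU : msize U = k.+3) :
  symmetric_scheme (@ekahan R d k Q M U).
Proof.
move=> h x; split; first exact: ekahan_rev.
move=> /ekahan_rev; rewrite opprK.
have -> // : (fun i => x (rev_ord (rev_ord i))) = x.
by apply/funext => i; rewrite rev_ordK.
Qed.
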